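(* Let $w,\tau,v\in W^P$ with $w\ge\tau\ge v$, and let $T_{w,\tau}^v$ be the Zariski tangent space to the Richardson variety $X_w^v$ at $e_\tau$. Then $$\{X_{-\beta}\ :\ \beta\in\tau(R^+\setminus R_P^+),\ w\ge s_\beta\tau\ge v\ (\mathrm{mod}\ W_P)\}$$ is a basis of $T_{w,\tau}^v$.
   Context: $K$ is an algebraically closed field of arbitrary characteristic, $1\le d<n$, $G=SL_n(K)$, $T$ the diagonal matrices, $B$ the upper triangular and $B^-$ the lower triangular matrices in $G$, $P=P_d\supset B$ the maximal parabolic subgroup of matrices whose lower-left $(n-d)\times d$ block is zero. $G/P$ is identified with the Grassmannian $G_{d,n}$ of $d$-dimensional subspaces of $K^n$. $W=S_n$ is the Weyl group, $W_P=S_d\times S_{n-d}$, $R$ the root system of $(G,T)$, $R^+$ the positive roots for $B$, $R_P^+$ the positive roots of $P$; thus $R^+\setminus R_P^+=\{\epsilon_j-\epsilon_i: 1\le j\le d<i\le n\}$. $s_\beta$ is the reflection for $\beta$ and $X_\alpha$ ($\alpha\in R$) is the Chevalley basis element of $\mathfrak g=\mathrm{Lie}\,G$ in the root space $\mathfrak g_\alpha$. $I_{d,n}=\{(i_1,\dots,i_d): 1\le i_1<\dots<i_d\le n\}$, ordered by $\underline i\ge\underline j\iff i_t\ge j_t$ for all $t$, is identified with $W/W_P$ and with the set $W^P\subset S_n$ of minimal coset representatives ($\underline i$ corresponds to the permutation with one-line notation $(i_1,\dots,i_d,j_1,\dots,j_{n-d})$, the $j$'s being the complement in increasing order). For $u\in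 W$, inequalities ''$w\ge u\ge v\ (\mathrm{mod}\ W_P)$'' refer to the element of $I_{d,n}$ corresponding to the coset $uW_P$, i.e. $\{u(1),\dots,u(d)\}$ sorted. For $\tau\in W^P$, $e_\tau=\tau P\in G/P$ is the corresponding $T$-fixed point (the span of $e_{\tau(1)},\dots,e_{\tau(d)}$). $X_w=\overline{Be_w}$ is the Schubert variety, $X^v=\overline{B^-e_v}$ the opposite Schubert variety, and $X_w^v=X_w\cap X^v$ the Richardson variety; for $w\ge v$ it is nonempty, reduced and irreducible. The tangent space to $G/P$ at $e_\tau$ is identified with $\bigoplus_{\beta\in\tau(R^+\setminus R_P^+)}\mathfrak g_{-\beta}$ (through the differential of $g\mapsto g e_\tau$), and $T_{w,\tau}^v$ is regarded as a subspace of it. *)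

(* Defs.v *)
(* MathComp, with multivariate polynomials from multinomials. *)
From mathcomp Require Import all_boot all_order all_fingroup all_algebra.
From mathcomp Require Import mpoly.

Set Implicit Arguments.
Unset Strict Implicit.
Unset Printing Implicit Defensive.

Import GRing.Theory.
Local Open Scope ring_scope.

(* Indices are 0-based: the index set {1, ..., n} is 'I_n, and "j <= d < i"
   becomes "j < d <= i". *)

Section WeylGroup.
Variables (n d : nat).
Implicit Types (u w : 'S_n) (b : 'I_n * 'I_n).

(* W^P: the permutations increasing on {0..d-1} and on {d..n-1}. *)
Definition minimal_rep u : Prop :=
  forall i j : 'I_n, (i < j)%N -> (i < d)%N = (j < d)%N -> (u i < u j)%N.

(* The element of I_{d,n} attached to the coset u W_P: the sorted sequence of
   the values u(i), i < d. *)
Definition coset_seq u : seq nat :=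
  sort leq [seq val (u i) | i : 'I_n <- enum 'I_n & (i < d)%N].

(* w >= u (mod W_P): the componentwise order on I_{d,n}. *)
Definition ge_modWP w u : bool := all2 leq (coset_seq u) (coset_seq w).

(* The pair (a, b), a != b, stands for the root epsilon_a - epsilon_b. *)
Definition opp_root b := (b.2, b.1).
Definition act_root u b := (u b.1, u b.2).
Definition reflection b : 'S_n := tperm b.1 b.2.

Definition pos_roots : {set 'I_n * 'I_n} := [set b : 'I_n * 'I_n | (b.1 < b.2)%N].
Definition pos_roots_P : {set 'I_n * 'I_n} :=
  [set b in pos_roots | (b.1 < d)%N == (b.2 < d)%N].

(* tau (R^+ \ R_P^+) *)
Definition tangent_roots u : {set 'I_n * 'I_n} :=
  [set act_root u b | b in pos_roots :\: pos_roots_P].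

(* The product of 'S_n is (s * t) i = t (s i), so the Weyl group element
   written s_beta u (first u, then s_beta) is u * s_beta here. *)
Definition refl_mul b u : 'S_n := (u * reflection b)%g.

End WeylGroup.

Section Grassmannian.
Variables (K : closedFieldType) (n d : nat).

Local Notation Vn := {vspace 'cV[K]_n}.
Implicit Types (g xi : 'M[K]_n) (A : 'M[K]_(n, d)) (U V : Vn) (X Z : Vn -> Prop).

Definition grassmannian V : Prop := \dim V = d.

Definition colspan A : Vn := <<[seq col j A | j : 'I_d]>>%VS.

(* The Pluecker coordinates are indexed by I_{d,n}, the strictly increasing
   d-tuples; they are computed on the matrices whose columns span the subspace,
   which determines them up to one common nonzero factor. *)
Definition plucker_index : finType :=
  {t : d.-tuple 'I_n | sorted ltn [seq val i | i <- t]}.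

Local Notation N := #|{: plucker_index}|.

Definition plucker (R : comNzRingType) (A : 'M[R]_(n, d)) (k : 'I_N) : R :=
  \det (rowsub (tnth (val (enum_val k : plucker_index))) A).

Definition homogeneous (F : {mpoly K[N]}) : Prop := exists k, F \is k.-homog.

Definition vanishes_at (F : {mpoly K[N]}) V : Prop :=
  forall A, colspan A = V -> F.@[plucker A] = 0.

Definition zariski_closed Z : Prop :=
  exists S : {mpoly K[N]} -> Prop,
    (forall F, S F -> homogeneous F) /\
    (forall V, Z V <-> grassmannian V /\ forall F, S F -> vanishes_at F V).

Definition zariski_closure X V : Prop :=
  forall Z, zariski_closed Z -> (forall U, X U -> Z U) -> Z V.

Definition borel g : Prop :=
  \det g = 1 /\ forall i j : 'I_n, (j < i)%N -> g i j = 0.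
Definition opp_borel g : Prop :=
  \det g = 1 /\ forall i j : 'I_n, (i < j)%N -> g i j = 0.

Definition subspace_act g V : Vn := (linfun (mulmx g) @: V)%VS.

Definition orbit_of (H : 'M[K]_n -> Prop) V U : Prop :=
  exists2 g, H g & U = subspace_act g V.

(* The T-fixed point e_u. *)
Definition fixed_point (u : 'S_n) : Vn :=
  <<[seq delta_mx (u i) ord0 | i : 'I_n <- enum 'I_n & (i < d)%N]>>%VS.

Definition schubert (w : 'S_n) : Vn -> Prop :=
  zariski_closure (orbit_of borel (fixed_point w)).
Definition opp_schubert (v : 'S_n) : Vn -> Prop :=
  zariski_closure (orbit_of opp_borel (fixed_point v)).
Definition richardson (w v : 'S_n) V : Prop := schubert w V /\ opp_schubert v V.

(* For X a reduced closed subvariety of the Grassmannian and A a matrix with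
   colspan A in X: u is tangent to X at the point [plucker A] of the projective
   space iff the differentials at plucker A of all homogeneous
   polynomials in the ideal of X vanish on u. Such a u matters only modulo
   the line through plucker A, on which these differentials vanish by Euler. *)
Definition proj_tangent X A (u : 'I_N -> K) : Prop :=
  forall F, homogeneous F -> (forall V, X V -> vanishes_at F V) ->
  \sum_(k < N) (F^`M(k)).@[plucker A] * u k = 0.

(* The differential at 1 of g |-> plucker (g A) in the direction xi: the
   coefficient of t in plucker ((1 + t xi) A). *)
Definition orbit_differential A xi (k : 'I_N) : K :=
  (plucker ((1%:M + 'X *: map_mx polyC xi) *m map_mx polyC A) k)`_1.

(* The matrix xi represents, through the differential of g |-> g V, a vector of
   the Zariski tangent space to X at V; this does not depend on the matrix A
   chosen to represent V. *)
Definition lie_tangent X V xi : Prop :=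
  forall A, colspan A = V -> proj_tangent X A (orbit_differential A xi).

Definition root_vector (b : 'I_n * 'I_n) : 'M[K]_n := delta_mx b.1 b.2.
Definition root_space (b : 'I_n * 'I_n) : {vspace 'M[K]_n} :=
  <[root_vector b]>%VS.

(* The direct sum of the g_{-beta}, beta in tau (R^+ \ R_P^+), identified with
   the tangent space to G/P at e_tau. *)
Definition grass_tangent (tau : 'S_n) : {vspace 'M[K]_n} :=
  (\sum_(b in tangent_roots d tau) root_space (opp_root b))%VS.

Definition richardson_tangent (w tau v : 'S_n) xi : Prop :=
  xi \in grass_tangent tau /\ lie_tangent (richardson w v) (fixed_point tau) xi.

(* [basis_of] for a subspace given as a Prop-valued predicate. *)
Definition is_basis (T : 'M[K]_n -> Prop) (s : seq 'M[K]_n) : Prop :=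
  free s /\ forall xi, T xi <-> xi \in <<s>>%VS.

End Grassmannian.

(* Main.v *)
(* A Pluecker coordinate p_u vanishes on X_w^v unless w >= u >= v, and the
   differential of p_(s_beta tau) at e_tau reads off the coefficient of X_(-beta);
   this bounds the tangent space from above.  Conversely, if tau and s_beta tau
   both lie between v and w, the punctured line (1 + t X_(-beta)) e_tau, t <> 0, lies
   in X_w^v: each of its points is the translate of e_tau by an element of one of
   B, B^- and the translate of e_(s_beta tau) by an element of the other, and
   H e_u is contained in the closure of H e_w for H = B, u <= w (resp. H = B^-, u >= w).
   A polynomial vanishing on the punctured line then has zero derivative
   along it at t = 0. *)
Require Import Defs.
From mathcomp Require Import all_boot all_order all_fingroup all_algebra.
From mathcomp Require Import mpoly.

Set Implicit Arguments.
Unset Strict Implicit.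
Unset Printing Implicit Defensive.

Import GRing.Theory.
Local Open Scope ring_scope.

(** * Polynomials in several variables along a polynomial curve, to first order *)

Section PolynomialCurves.
Variables (K : closedFieldType) (N : nat).
Implicit Types (F : {mpoly K[N]}) (p : 'I_N -> {poly K}).

Lemma horner_mmap F p t : (mmap polyC p F).[t] = F.@[fun k => (p k).[t]].
Proof.
elim/mpolyind: F => [|c m F _ _ IH]; first by rewrite mmap0 meval0 horner0.
rewrite mmapD mmapZ mmapX mevalD mevalZ mevalX hornerD hornerM hornerC IH.
rewrite /mmap1 horner_prod; congr (_ * _ + _).
by apply: eq_bigr => i _; rewrite horner_exp.
Qed.

Lemma coef1M (R : nzSemiRingType) (f g : {poly R}) :
  (f * g)`_1 = f`_0 * g`_1 + f`_1 * g`_0.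
Proof. by rewrite coefM !big_ord_recr big_ord0 /= add0r. Qed.

(** Chain rule at t = 0 for F composed with the curve [p]. Both sides are additive in [F] and obey
    the Leibniz rule, so constants and variables suffice. Reading off a coefficient instead of
    differentiating keeps the argument independent of the characteristic. *)
Lemma coef1_mmap F p :
  (mmap polyC p F)`_1 =
  \sum_k F^`M(k).@[fun k => (p k)`_0] * (p k)`_1.
Proof.
pose Q G := (mmap polyC p G)`_1 =
  \sum_k G^`M(k).@[fun k => (p k)`_0] * (p k)`_1.
have coef0 G : (mmap polyC p G)`_0 = G.@[fun k => (p k)`_0].
  by rewrite -horner_coef0 horner_mmap; apply: meval_eq => k; rewrite horner_coef0.
have QM G H : Q G -> Q H -> Q (G * H).
  move=> QG QH; rewrite /Q rmorphM /= coef1M QG QH !coef0 mulr_sumr mulr_suml.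
  rewrite -big_split /=; apply: eq_bigr => k _.
  by rewrite mderivM mevalD !mevalM mulrDl addrC mulrA mulrAC.
have QD G H : Q G -> Q H -> Q (G + H).
  move=> QG QH; rewrite /Q mmapD coefD QG QH -big_split /=.
  by apply: eq_bigr => k _; rewrite mderivD mevalD mulrDl.
have QC c : Q c%:MP.
  rewrite /Q mmapC coefC /= big1 // => k _.
  by rewrite mderivC meval0 mul0r.
have Q1 : Q 1 by have := QC 1; rewrite mpolyC1.
have QX i : Q 'X_i.
  rewrite /Q mmapX mmap1U (bigD1 i) //= big1 => [|k /negbTE ki].
    (* The exponent left after differentiating is [U_(i) - U_(i)]; padding it with 0 on the left
       lets [addmK] reduce it to 0. *)
    rewrite addr0 mderivX mnm1E eqxx scale1r -[X in (X - _)%MM]add0m addmK.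
    by rewrite mpolyX0 meval1 mul1r.
  by rewrite mderivX mnm1E eq_sym ki scale0r meval0 mul0r.
have QXn i j : Q ('X_i ^+ j).
  elim: j => [|j IH]; first by rewrite expr0.
  by rewrite exprS; apply: (QM).
elim/mpolyind: F => [|c m F _ _ IH]; first by have := QC 0; rewrite mpolyC0.
apply: (QD) => //; rewrite -mul_mpolyC; apply: (QM); first exact: QC.
by rewrite mpolyXE_id; elim/big_ind: _ => [|G H|i _]; [exact: Q1 | exact: QM | exact: QXn].
Qed.

(** An algebraically closed field is infinite: if f were nonzero, f times the variable would have a
    non-root, and such a point is nonzero and not a root of f. *)
Lemma poly_zero_off0 (f : {poly K}) : (forall t, t != 0 -> f.[t] = 0) -> f = 0.
Proof.
move=> f0; apply/eqP; apply: contraTT isT => nzf.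
have /closed_nonrootP[t] : f * 'X != 0 by rewrite mulf_neq0 ?polyX_eq0.
rewrite /root hornerM hornerX; case: (eqVneq t 0) => [->|/f0->].
  by rewrite mulr0 eqxx.
by rewrite mul0r eqxx.
Qed.

Lemma mmap_zero_off0 F p :
  (forall t, t != 0 -> F.@[fun k => (p k).[t]] = 0) -> mmap polyC p F = 0.
Proof. by move=> F0; apply: poly_zero_off0 => t /F0; rewrite horner_mmap. Qed.

Lemma meval_homogM F k c (x : 'I_N -> K) :
  F \is k.-homog -> F.@[fun i => c * x i] = c ^+ k * F.@[x].
Proof.
move=> /dhomogP Fk; rewrite !mevalE mulr_sumr !big_seq; apply: eq_bigr => m /Fk mk.
rewrite mulrCA; congr (_ * _); rewrite -mk /= mdegE expr_sum -big_split.
by apply: eq_bigr => i _; rewrite exprMn.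
Qed.

End PolynomialCurves.

(** * The order on I_{d,n} through increasing enumerations of cosets *)

Section CosetEnumeration.
Variables (n d : nat).
Hypothesis d_le_n : (d <= n)%N.
Implicit Types u w : 'S_n.

(** Counterpart of [coset_seq] with values kept in ['I_n], so that it can select rows of a
    matrix. *)
Definition coset_ord_seq u : seq 'I_n :=
  sort (relpre val leq) [seq u i | i : 'I_n <- enum 'I_n & (i < d)%N].

Lemma map_coset_ord_seq u : map val (coset_ord_seq u) = coset_seq d u.
Proof. by rewrite /coset_ord_seq -sort_map -map_comp. Qed.

Lemma size_coset_ord_seq u : size (coset_ord_seq u) == d.
Proof.
rewrite size_sort size_map -(size_map val) -[filter _ _]/(filter (preim val (gtn d)) _).
(* The range 0..n-1 is cut at d: the filter keeps all of the first piece and nothing of the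
   second. *)
rewrite -filter_map val_enum_ord -[X in filter _ (iota 0 X)](subnKC d_le_n) iotaD.
rewrite filter_cat add0n (eq_in_filter (a2 := predT)) => [|x]; last first.
  by rewrite mem_iota /= add0n.
rewrite filter_predT (eq_in_filter (a2 := pred0)) => [|x].
  by rewrite filter_pred0 cats0 size_iota.
by rewrite mem_iota /= => /andP[dx _]; rewrite ltnNge dx.
Qed.

Lemma mem_coset_ord_seq u i :
  (u i \in coset_ord_seq u) = (i < d)%N.
Proof.
rewrite mem_sort mem_map; last exact: perm_inj.
by rewrite mem_filter mem_enum andbT.
Qed.

Lemma sorted_coset_ord_seq u : sorted ltn (map val (coset_ord_seq u)).
Proof.
rewrite ltn_sorted_uniq_leq map_inj_uniq; last exact: val_inj.
rewrite sort_uniq map_inj_uniq; last exact: perm_inj.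
rewrite filter_uniq ?enum_uniq //=.
by rewrite map_coset_ord_seq; apply: sort_sorted; apply: leq_total.
Qed.

Definition coset_index u : plucker_index n d :=
  Sub (Tuple (size_coset_ord_seq u)) (sorted_coset_ord_seq u).

Definition coset_enum u : 'I_d -> 'I_n := tnth (val (coset_index u)).

Lemma coset_enum_nth u x0 (j : 'I_d) : coset_enum u j = nth x0 (coset_ord_seq u) j.
Proof. by rewrite /coset_enum (tnth_nth x0). Qed.

Lemma coset_enum_nat u (j : 'I_d) : val (coset_enum u j) = nth 0 (coset_seq d u) j.
Proof.
rewrite -map_coset_ord_seq (coset_enum_nth u (coset_enum u j)).
by rewrite (nth_map (coset_enum u j)) // (eqP (size_coset_ord_seq u)).
Qed.

Lemma coset_enum_lt u (i j : 'I_d) : (i < j)%N -> (coset_enum u i < coset_enum u j)%N.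
Proof.
move=> ij; rewrite !coset_enum_nat -map_coset_ord_seq.
apply: (sorted_ltn_nth ltn_trans) => //; first exact: sorted_coset_ord_seq.
all: by rewrite inE size_map (eqP (size_coset_ord_seq u)).
Qed.

Lemma coset_enum_inj u : injective (coset_enum u).
Proof.
move=> i j eij; apply: val_inj.
by case: (ltngtP i j) => // /(coset_enum_lt u); rewrite eij ltnn.
Qed.

Lemma coset_enumP u x : reflect (exists j, x = coset_enum u j) (x \in coset_ord_seq u).
Proof. exact: (tnthP (val (coset_index u))). Qed.

Lemma coset_enum_range u i : (exists j, u i = coset_enum u j) <-> (i < d)%N.
Proof. by rewrite -(mem_coset_ord_seq u); split=> /coset_enumP. Qed.

Lemma ge_modWPP w u :
  reflect (forall j : 'I_d, (coset_enum u j <= coset_enum w j)%N) (ge_modWP d w u).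
Proof.
have sz (v : 'S_n) : size (coset_seq d v) = d.
  by rewrite -map_coset_ord_seq size_map (eqP (size_coset_ord_seq v)).
rewrite /ge_modWP all2E !sz eqxx.
have szz : size (zip (coset_seq d u) (coset_seq d w)) = d by rewrite size1_zip ?sz.
apply: (iffP (all_nthP (0, 0)%N)) => [le_uw j | le_uw i].
  by have := le_uw j; rewrite szz ltn_ord nth_zip ?sz //= !coset_enum_nat => ->.
rewrite szz => id; rewrite nth_zip ?sz //=.
by have := le_uw (Ordinal id); rewrite !coset_enum_nat.
Qed.

End CosetEnumeration.

(** Pigeonhole: if f i0 < k i0, monotonicity forces [s] to send every index >= i0 to an index > i0,
    and there are too few of the latter. *)
Lemma perm_leq_pointwise n d (k f : 'I_d -> 'I_n) (s : 'S_d) :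
  {homo k : i j / (i < j)%N >-> (i < j)%N} ->
  {homo f : i j / (i < j)%N >-> (i < j)%N} ->
  (forall i, k i <= f (s i))%N -> forall i, (k i <= f i)%N.
Proof.
move=> k_incr f_incr le_kf i0; rewrite leqNgt; apply/negP => lt_fk.
pose S := [set i : 'I_d | (i0 <= i)%N]; pose S' := [set i : 'I_d | (i0 < i)%N].
have : (#|s @: S| <= #|S'|)%N.
  apply/subset_leq_card/subsetP => _ /imsetP[i + ->]; rewrite !inE => le_i.
  rewrite ltnNge; apply/negP => le_si.
  have mono (g : 'I_d -> 'I_n) : {homo g : i j / (i < j)%N >-> (i < j)%N} ->
      forall i j : 'I_d, (i <= j)%N -> (g i <= g j)%N.
    move=> g_incr a b; rewrite leq_eqVlt => /orP[/eqP/val_inj->//|/g_incr/ltnW//].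
  have := leq_trans (leq_trans (mono k k_incr _ _ le_i) (le_kf i))
    (mono f f_incr _ _ le_si).
  by rewrite leqNgt lt_fk.
rewrite card_imset; last exact: perm_inj.
apply/negP; rewrite -ltnNge; apply/proper_card/properP; split.
  by apply/subsetP => i; rewrite !inE => /ltnW.
by exists i0; rewrite !inE ?ltnn.
Qed.

(** * Subspaces as column spans and the behaviour of Pluecker coordinates *)

Section ColumnSpaces.
Variables (K : closedFieldType) (n d : nat).
Implicit Types (g : 'M[K]_n) (A B M : 'M[K]_(n, d)).

(** No monotonicity is imposed on [f]: the same fixed point is later presented with its basis
    vectors in different orders. *)
Definition coord_mx (f : 'I_d -> 'I_n) : 'M[K]_(n, d) := colsub f 1%:M.

Lemma mulmx_coord m (g : 'M[K]_(m, n)) f : g *m coord_mx f = colsub f g.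
Proof.
rewrite /coord_mx -[in RHS](mulmx1 g) mxsub_mul; congr (_ *m _).
by apply/matrixP => i j; rewrite mxE.
Qed.

Lemma subspace_act_colspan g A : subspace_act g (colspan A) = colspan (g *m A).
Proof.
rewrite /subspace_act /colspan limg_span -map_comp; congr <<_>>%VS.
by apply: eq_map => j /=; rewrite lfunE /= colE mulmxA -colE.
Qed.

Lemma mem_colspan A x : x \in colspan A -> exists c, x = A *m c.
Proof.
move=> xA; pose t := [tuple col j A | j < d].
have {xA}/coord_span -> : x \in <<t>>%VS.
  by rewrite (_ : <<t>>%VS = colspan A).
exists (\col_j coord t j x); apply/colP => i; rewrite mxE summxE.
by apply: eq_bigr => j _; rewrite (nth_map j) ?size_enum_ord // nth_ord_enum !mxE mulrC.
Qed.

Lemma colspan_factor A M : colspan A = colspan M -> exists C, A = M *m C.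
Proof.
move=> AM; have /fin_all_exists[c cP] j : exists c, col j A = M *m c.
  by apply: mem_colspan; rewrite -AM; apply/memv_span/map_f/mem_enum.
exists (\matrix_(i, j) c j i 0); apply/matrixP => i j.
have /colP/(_ i) := cP j; rewrite !mxE => ->.
by apply: eq_bigr => l _; rewrite mxE.
Qed.

Lemma colspan_scale_col A B (c : 'I_d -> K) :
  (forall j, c j != 0) -> (forall i j, B i j = c j * A i j) ->
  colspan B = colspan A.
Proof.
move=> nzc BA; have colBA j : col j B = c j *: col j A.
  by apply/colP => i; rewrite !mxE BA.
apply/eqP; rewrite eqEsubv; apply/andP; split.
all: apply/span_subvP => _ /mapP[j _ ->].
  by rewrite colBA; apply/memvZ/memv_span/map_f/mem_enum.
have -> : col j A = (c j)^-1 *: col j B by rewrite colBA scalerA mulVf ?scale1r.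
by apply/memvZ/memv_span/map_f/mem_enum.
Qed.

Lemma dim_colspan (A : 'M[K]_(n, d)) (L : 'M[K]_(d, n)) :
  L *m A = 1%:M -> \dim (colspan A) = d.
Proof.
move=> LA; pose t := [tuple col j A | j < d].
suff : free t by rewrite /free size_tuple => /eqP.
apply/freeP => k k0 j.
have Ak : A *m (\col_j k j) = 0.
  rewrite -k0; apply/colP => i; rewrite mxE summxE; apply: eq_bigr => l _.
  by rewrite (nth_map l) ?size_enum_ord // nth_ord_enum !mxE mulrC.
have := congr1 (fun x => (L *m x) j 0) Ak.
by rewrite mulmx0 mulmxA LA mul1mx !mxE.
Qed.

Lemma grassmannian_act g f : injective f -> g \in unitmx ->
  grassmannian d (colspan (g *m coord_mx f)).
Proof.
move=> injf ug; apply: (@dim_colspan _ (rowsub f 1%:M *m invmx g)).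
rewrite mulmxA -(mulmxA _ (invmx g)) mulVmx // mulmx1 mulmx_coord.
by apply/matrixP => i j; rewrite !mxE (inj_eq injf).
Qed.

Lemma fixed_pointE (u : 'S_n) f :
  (forall i, (exists j, u i = f j) <-> (i < d)%N) ->
  fixed_point K d u = colspan (coord_mx f).
Proof.
move=> fP; have colf j : col j (coord_mx f) = delta_mx (f j) 0.
  by apply/colP => i; rewrite !mxE eqxx andbT.
apply: eq_span => x; apply/mapP/mapP => -[i].
  rewrite mem_filter => /andP[/fP[j uij] _] ->.
  by exists j; rewrite ?mem_enum // colf uij.
move=> _ ->; have ltd : ((u^-1)%g (f i) < d)%N.
  by apply/fP; exists i; rewrite permKV.
exists ((u^-1)%g (f i)); last by rewrite permKV colf.
by rewrite mem_filter mem_enum andbT.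
Qed.

Lemma plucker_mulmxr A (C : 'M[K]_d) k :
  plucker (A *m C) k = plucker A k * \det C.
Proof. by rewrite /plucker -mul_rowsub_mx det_mulmx. Qed.

(** Any other matrix with the same span is M C, whose Pluecker coordinates are those of M times det
    C. By homogeneity F is only multiplied by a power of det C, so one spanning matrix is enough to
    test vanishing. *)
Lemma vanishes_at_colspan F M : homogeneous F ->
  F.@[plucker M] = 0 -> vanishes_at F (colspan M).
Proof.
move=> [k Fk] FM A /colspan_factor[C ->].
rewrite (meval_eq (v2 := fun i => \det C * plucker M i)) => [|i].
  by rewrite (meval_homogM _ _ Fk) FM mulr0.
by rewrite plucker_mulmxr mulrC.
Qed.

Lemma horner_plucker (M : 'M[{poly K}]_(n, d)) k t :
  (plucker M k).[t] = plucker (map_mx (horner_eval t) M) k.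
Proof. by rewrite /plucker -horner_evalE -det_map_mx map_mxsub. Qed.

Lemma closure_mono (X Y : {vspace 'cV[K]_n} -> Prop) V :
  (forall U, X U -> Y U) -> zariski_closure d X V -> zariski_closure d Y V.
Proof. by move=> XY XV Z Zc YZ; apply: XV => // U /XY /YZ. Qed.

End ColumnSpaces.

(** * Linearity of the orbit differential and tangent vectors from curves *)

Section OrbitDifferential.
Variables (K : closedFieldType) (n d : nat).
Implicit Types (A : 'M[K]_(n, d)) (xi : 'M[K]_n).

(** The linear coefficient of a product is a sum of terms, each with one linear coefficient and
    otherwise constant terms. With the constant terms common to the three families, it depends
    linearly on the linear coefficients. *)
Lemma coef1_prod_linear (I : Type) (s : seq I) (P P1 P2 : I -> {poly K}) c :
  (forall i, (P1 i)`_0 = (P i)`_0) -> (forall i, (P2 i)`_0 = (P i)`_0) ->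
  (forall i, (P i)`_1 = c * (P1 i)`_1 + (P2 i)`_1) ->
  (\prod_(i <- s) P i)`_1 =
  c * (\prod_(i <- s) P1 i)`_1 + (\prod_(i <- s) P2 i)`_1.
Proof.
move=> P10 P20 PE; elim: s => [|i s IH]; first by rewrite !big_nil !coef1 mulr0 addr0.
have prod0 (Q : I -> {poly K}) : (forall i, (Q i)`_0 = (P i)`_0) ->
    (\prod_(i <- s) Q i)`_0 = (\prod_(i <- s) P i)`_0.
  by move=> Q0; rewrite !coef0_prod; apply: eq_bigr => j _.
rewrite !big_cons !coef1M IH PE !P10 !P20 !prod0 //.
rewrite !mulrDr !mulrDl !mulrA [_`_0 * c]mulrC -!addrA; congr (_ + _).
by rewrite addrCA.
Qed.

Lemma coef1_det_linear m (M M1 M2 : 'M[{poly K}]_m) c :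
  (forall i j, (M1 i j)`_0 = (M i j)`_0) -> (forall i j, (M2 i j)`_0 = (M i j)`_0) ->
  (forall i j, (M i j)`_1 = c * (M1 i j)`_1 + (M2 i j)`_1) ->
  (\det M)`_1 = c * (\det M1)`_1 + (\det M2)`_1.
Proof.
move=> M10 M20 ME; rewrite !coef_sum mulr_sumr -big_split.
apply: eq_bigr => s _ /=; rewrite !mulr_sign.
have := @coef1_prod_linear _ (index_enum 'I_m) (fun i => M i (s i))
  (fun i => M1 i (s i)) (fun i => M2 i (s i)) c
  (fun i => M10 _ _) (fun i => M20 _ _) (fun i => ME _ _).
by case: (odd_perm s) => E; rewrite ?coefN E // opprD mulrN.
Qed.

Lemma orbit_curveE A xi :
  (1%:M + 'X *: map_mx polyC xi) *m map_mx polyC A =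
  map_mx polyC A + 'X *: map_mx polyC (xi *m A).
Proof. by rewrite mulmxDl mul1mx -scalemxAl map_mxM. Qed.

Lemma orbit_differential_linear A c xi xi' k :
  orbit_differential A (c *: xi + xi') k =
  c * orbit_differential A xi k + orbit_differential A xi' k.
Proof.
rewrite /orbit_differential !orbit_curveE.
have c0 (y x : K) : (y%:P + 'X * x%:P)`_0 = y.
  by rewrite coefD coefC coefXM addr0.
have c1 (y x : K) : (y%:P + 'X * x%:P)`_1 = x.
  by rewrite coefD coefC coefXM coefC add0r.
have entry B (f : 'I_d -> 'I_n) i j :
    rowsub f (map_mx polyC A + 'X *: map_mx polyC B) i j =
    (A (f i) j)%:P + 'X * (B (f i) j)%:P by rewrite !mxE.
apply: coef1_det_linear => i j; rewrite !entry ?c0 ?c1 //.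
rewrite mulmxDl -scalemxAl.
by rewrite [LHS]mxE [X in X + _ = _]mxE.
Qed.

Lemma lie_tangent_linear (X : {vspace 'cV[K]_n} -> Prop) V c xi xi' :
  lie_tangent d X V xi -> lie_tangent d X V xi' ->
  lie_tangent d X V (c *: xi + xi').
Proof.
move=> Txi Txi' A AV F Fh FX.
rewrite (eq_bigr (fun k => c * (F^`M(k).@[plucker A] * orbit_differential A xi k) +
  F^`M(k).@[plucker A] * orbit_differential A xi' k)) => [|k _].
  by rewrite big_split -mulr_sumr /= Txi // Txi' // mulr0 addr0.
by rewrite orbit_differential_linear mulrDr mulrCA.
Qed.

Lemma lie_tangent0 (X : {vspace 'cV[K]_n} -> Prop) V : lie_tangent d X V 0.
Proof.
move=> A AV F _ _; rewrite big1 // => k _.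
rewrite /orbit_differential orbit_curveE mul0mx map_mx0 scaler0 addr0.
by rewrite /plucker -map_mxsub det_map_mx coefC mulr0.
Qed.

Lemma lie_tangent_span (X : {vspace 'cV[K]_n} -> Prop) V s xi :
  {in s, forall x, lie_tangent d X V x} -> xi \in <<s>>%VS -> lie_tangent d X V xi.
Proof.
move=> Ts /(coord_span (X := in_tuple s)) ->.
elim/big_ind: _ => [|x y Tx Ty|i _]; first exact: lie_tangent0.
  by rewrite -[x]scale1r; apply: lie_tangent_linear.
rewrite -[_ *: _]addr0; apply: lie_tangent_linear; last exact: lie_tangent0.
by apply: Ts; apply: mem_nth.
Qed.

(** If F vanishes on X, its pullback to the line is a polynomial in t that is zero for all t != 0,
    hence identically zero. Its linear coefficient is the required differential by [coef1_mmap]. The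
    point t = 0 itself need not be known to lie in X. *)
Lemma lie_tangent_curve (X : {vspace 'cV[K]_n} -> Prop) V xi :
  (forall t, t != 0 -> X (subspace_act (1%:M + t *: xi) V)) ->
  lie_tangent d X V xi.
Proof.
move=> Xt A AV F _ FX.
set M := (1%:M + 'X *: map_mx polyC xi) *m map_mx polyC A.
have MtE t : map_mx (horner_eval t) M = (1%:M + t *: xi) *m A.
  rewrite /M orbit_curveE mulmxDl mul1mx -scalemxAl.
  apply/matrixP => i j; rewrite !mxE horner_evalE.
  by rewrite hornerD hornerM hornerX !hornerC.
have M0 : mmap polyC (plucker M) F = 0.
  apply: mmap_zero_off0 => t nzt.
  rewrite (meval_eq (v2 := plucker ((1%:M + t *: xi) *m A))) => [|k].
    by apply: (FX _ (Xt t nzt)); rewrite -AV subspace_act_colspan.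
  by rewrite horner_plucker MtE.
have := congr1 (fun f : {poly K} => f`_1) M0; rewrite coef1_mmap coef0 => E.
rewrite -[RHS]E; apply: eq_bigr => k _; congr (_ * _).
apply: meval_eq => l; rewrite -horner_coef0 horner_plucker MtE.
by rewrite scale0r addr0 mul1mx.
Qed.

End OrbitDifferential.

(** * Spans of root vectors and the tangent space of the Grassmannian *)

Section RootVectors.
Variables (K : closedFieldType) (n d : nat).
Implicit Types (ps : seq ('I_n * 'I_n)) (xi : 'M[K]_n).

Lemma span_root_vectorP ps xi :
  reflect (forall i j, (i, j) \notin ps -> xi i j = 0)
    (xi \in <<[seq root_vector K p | p <- ps]>>%VS).
Proof.
apply: (iffP idP) => [/(coord_span (X := in_tuple _)) -> i j ij|xi0].
  rewrite summxE big1 // => l _; rewrite mxE.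
  have /mapP[p pps /= ->] : (in_tuple [seq root_vector K p | p <- ps])`_l
      \in [seq root_vector K p | p <- ps] by apply: mem_nth.
  rewrite mxE; case: andP => [[/eqP ei /eqP ej]|]; last by rewrite mulr0.
  by rewrite ei ej -surjective_pairing pps in ij.
rewrite [xi]matrix_sum_delta; apply: memv_suml => i _; apply: memv_suml => j _.
have [ij|/xi0->] := boolP ((i, j) \in ps); last by rewrite scale0r mem0v.
by apply/memvZ/memv_span/mapP; exists (i, j).
Qed.

Lemma free_root_vectors ps : uniq ps -> free [seq root_vector K p | p <- ps].
Proof.
elim: ps => [|p ps IH] /=; first by rewrite nil_free.
move=> /andP[pps /IH fps]; rewrite free_cons fps andbT.
apply/negP => /span_root_vectorP/(_ p.1 p.2); rewrite -surjective_pairing => /(_ pps).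
by rewrite mxE !eqxx => /eqP; rewrite oner_eq0.
Qed.

Lemma grass_tangent_support (u : 'S_n) xi i j :
  xi \in grass_tangent K d u -> (j, i) \notin tangent_roots d u -> xi i j = 0.
Proof.
move=> /memv_sumP[vs vsP ->] ji; rewrite summxE big1 // => b bu.
have /vlineP[c ->] := vsP b bu; rewrite !mxE.
case: andP => [[/eqP ei /eqP ej]|]; last by rewrite mulr0.
by rewrite ei ej /= -surjective_pairing bu in ji.
Qed.

(** A pair i < j with i and j on different sides of d must satisfy i < d <= j. *)
Lemma tangent_rootsP (u : 'S_n) b :
  reflect ((exists2 i : 'I_n, (i < d)%N & b.1 = u i) /\
           (exists2 j : 'I_n, (d <= j)%N & b.2 = u j))
    (b \in tangent_roots d u).
Proof.
apply: (iffP imsetP) => [[[i j]]|[[i id b1] [j dj b2]]].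
  rewrite !inE /= => + ->; rewrite andbC => /andP[ij]; rewrite ij /= => ndij.
  have [id|di] := ltnP i d; have [jd|dj] := ltnP j d; rewrite ?id ?jd in ndij *.
  - by [].
  - by split; [exists i|exists j].
  - by have := leq_trans (leq_trans jd di) (ltnW ij); rewrite ltnn.
  - by move: ndij; rewrite !ltnNge di dj.
exists (i, j); last by rewrite /act_root -b1 -b2 -surjective_pairing.
by rewrite !inE /= (leq_trans id dj) id ltnNge dj.
Qed.

End RootVectors.

(** * Orbit closures of a triangular group, for B and B^- at once *)

Section TriangularOrbits.
Variables (K : closedFieldType) (n d : nat) (r : rel 'I_n).
Hypothesis r_refl : reflexive r.
Hypothesis r_trans : transitive r.
Hypothesis det_r : forall g : 'M[K]_n,
  (forall i j, ~~ r i j -> g i j = 0) -> \det g = \prod_i g i i.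
Hypothesis r_perm : forall (k f : 'I_d -> 'I_n) (s : 'S_d),
  {homo k : i j / (i < j)%N >-> (i < j)%N} ->
  {homo f : i j / (i < j)%N >-> (i < j)%N} ->
  (forall i, r (k i) (f (s i))) -> forall i, r (k i) (f i).

(** The relation [r] is the allowed pattern of nonzero entries: <= on indices gives B, and >= gives
    B^-. *)
Definition tri_group (g : 'M[K]_n) :=
  \det g = 1 /\ forall i j, ~~ r i j -> g i j = 0.

Lemma tri_group_unit g : tri_group g -> g \in unitmx.
Proof. by case=> det1 _; rewrite unitmxE det1 unitr1. Qed.

Lemma tri_groupM g h : tri_group g -> tri_group h -> tri_group (g *m h).
Proof.
move=> [dg g0] [dh h0]; split=> [|i j nrij]; first by rewrite det_mulmx dg dh mulr1.
rewrite mxE big1 // => l _; have [ril|/g0->] := boolP (r i l); last by rewrite mul0r.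
rewrite h0 ?mulr0 //; apply: contraNN nrij; exact: r_trans ril.
Qed.

(* The free index outside the range of [f] is used to normalise the
   determinant. *)
Lemma tri_group_extend (f : 'I_d -> 'I_n) (M : 'M[K]_(n, d)) :
  (d < n)%N -> injective f ->
  (forall i j, ~~ r i (f j) -> M i j = 0) -> (forall j, M (f j) j != 0) ->
  exists2 g, tri_group g & g *m coord_mx K f = M.
Proof.
move=> dn injf M0 Mf.
have [l0 l0f] : exists l0, l0 \notin codom f.
  apply/existsP; apply: contraTT dn; rewrite negb_exists -leqNgt => /forallP allf.
  have : (#|'I_n| <= #|codom f|)%N.
    by apply/subset_leq_card/subsetP => x _; have := allf x; rewrite negbK.
  by rewrite (card_codom injf) !card_ord.
(* The column of index f j is column j of [M]; the remaining columns come from the identity, with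
   [c] in place of 1 at [l0]. *)
pose G c : 'M[K]_n := \matrix_(i, l)
  if [pick j | f j == l] is Some j then M i j
  else (i == l)%:R * (if l == l0 then c else 1).
have Gf c i j : G c i (f j) = M i j.
  rewrite mxE; case: pickP => [j' /eqP/injf -> //|/(_ j)].
  by rewrite eqxx.
have Gl0 c : G c l0 l0 = c.
  rewrite mxE; case: pickP => [j' /eqP fj|_]; last by rewrite !eqxx mul1r.
  by rewrite -fj codom_f in l0f.
have Gdiag c l : l != l0 -> G c l l = G 1 l l /\ G c l l != 0.
  move=> ll0; rewrite !mxE; case: pickP => [j' /eqP <-|_] //.
  by rewrite (negbTE ll0) eqxx mulr1 oner_eq0.
have Gtri c i l : ~~ r i l -> G c i l = 0.
  move=> nr; rewrite mxE; case: pickP => [j' /eqP fj|_]; first by rewrite M0 // fj.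
  by case: eqP nr => [->|]; rewrite ?r_refl ?mul0r.
(* The diagonal entries away from [l0] do not depend on [c], so they may be computed with c = 1;
   this choice makes the determinant 1. *)
pose c := (\prod_(l | l != l0) G 1 l l)^-1.
exists (G c); last by apply/matrixP => i j; rewrite mulmx_coord mxE Gf.
split; last exact: Gtri.
rewrite (det_r (@Gtri c)) (bigD1 l0) //= Gl0.
rewrite (eq_bigr (fun l => G 1 l l)) => [|l /(Gdiag c)[]//].
by rewrite mulVf //; apply/prodf_neq0 => l /(Gdiag 1)[].
Qed.

(* The curve s |-> span (e_{f_u j} + s e_{f_w j}) runs inside the orbit of the
   larger fixed point for s <> 0 and specialises to the smaller one at s = 0. *)
Lemma tri_orbit_closure (fu fw : 'I_d -> 'I_n) b :
  (d < n)%N -> injective fu -> injective fw -> (forall j, r (fu j) (fw j)) ->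
  tri_group b ->
  zariski_closure d (orbit_of tri_group (colspan (coord_mx K fw)))
    (colspan (b *m coord_mx K fu)).
Proof.
move=> dn injfu injfw r_uw tb Z [S [Shom ZP]] orbZ.
apply/ZP; split; first exact/grassmannian_act/tri_group_unit.
move=> F SF; apply: vanishes_at_colspan; first exact: Shom.
(* Columns with fu j = fw j are left unmoved: adding s e_{fw j} there would give (1 + s) e_{fw j},
   which dies at s = -1. *)
pose D : 'M[K]_(n, d) := \matrix_(i, j) ((fu j != fw j) && (i == fw j))%:R.
pose M : 'M[{poly K}]_(n, d) :=
  map_mx polyC (b *m coord_mx K fu) + 'X *: map_mx polyC (b *m D).
have MtE t : map_mx (horner_eval t) M = b *m (coord_mx K fu + t *: D).
  apply/matrixP => i j; rewrite mulmxDr -scalemxAr !mxE horner_evalE.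
  by rewrite hornerD hornerM hornerX !hornerC.
have M0 : mmap polyC (plucker M) F = 0.
  apply: mmap_zero_off0 => t nzt.
  have [|j|g tg gM] := @tri_group_extend fw (coord_mx K fu + t *: D) dn injfw.
  - move=> i j nr; rewrite !mxE.
    have /negbTE-> : i != fu j by apply: contraNneq nr => ->.
    have /negbTE-> : i != fw j by apply: contraNneq nr => ->.
    by rewrite andbF mulr0 addr0.
  - rewrite !mxE eqxx andbT [fu j == fw j]eq_sym; case: (eqVneq (fw j) (fu j)) => _ /=.
      by rewrite mulr0 addr0 oner_eq0.
    by rewrite add0r mulr1.
  have orb : orbit_of tri_group (colspan (coord_mx K fw))
      (colspan (b *m (coord_mx K fu + t *: D))).
    exists (b *m g); first exact: tri_groupM.
    by rewrite subspace_act_colspan -mulmxA gM.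
  have /ZP[_ /(_ F SF) Fvan] := orbZ _ orb.
  rewrite -[RHS](Fvan _ erefl); apply: meval_eq => k.
  by rewrite horner_plucker MtE.
(* The pullback of F is identically zero, so it may be evaluated at 0, where the curve is b
   e_{fu}. *)
have := congr1 (horner^~ 0) M0; rewrite horner_mmap horner0 => <-.
by apply: meval_eq => k; rewrite horner_plucker MtE scale0r addr0.
Qed.

(** On the orbit the coordinate is a minor of a triangular matrix. A nonzero term of its Leibniz
    expansion would match k to f through some permutation, hence termwise by [r_perm], against the
    hypothesis. The zero locus is closed, so vanishing passes to the closure. *)
Lemma tri_closure_plucker0 (k : plucker_index n d) (f : 'I_d -> 'I_n) V :
  {homo f : i j / (i < j)%N >-> (i < j)%N} -> injective f ->
  (exists i, ~~ r (tnth (val k) i) (f i)) ->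
  zariski_closure d (orbit_of tri_group (colspan (coord_mx K f))) V ->
  vanishes_at ('X_(enum_rank k) : {mpoly K[#|{: plucker_index n d}|]}) V.
Proof.
move=> f_incr injf [i0 nr_i0] clV.
have Xhom : homogeneous ('X_(enum_rank k) : {mpoly K[#|{: plucker_index n d}|]}).
  by exists 1%N; rewrite dhomogX /= mdeg1.
have k_incr : {homo tnth (val k) : i j / (i < j)%N >-> (i < j)%N}.
  move=> i j ij; pose s := [seq val i | i <- val k].
  have s_sorted : sorted ltn s := valP k.
  have sz : size s = d by rewrite size_map size_tuple.
  have nths l : val (tnth (val k) l) = nth 0%N s l.
    by rewrite (tnth_nth (tnth (val k) l)) (nth_map (tnth (val k) l)) ?size_tuple.
  rewrite !nths; apply: (sorted_ltn_nth ltn_trans) => //.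
    by rewrite inE sz.
  by rewrite inE sz.
pose Z V := grassmannian d V /\
  vanishes_at ('X_(enum_rank k) : {mpoly K[#|{: plucker_index n d}|]}) V.
suff [] : Z V by [].
apply: clV => [|_ [g tg ->]].
  exists (eq 'X_(enum_rank k)); split=> [_ <- //|U].
  split=> -[gU XU]; split=> //; first by move=> _ <-.
  exact: XU.
rewrite subspace_act_colspan; split; first exact/grassmannian_act/tri_group_unit.
apply: vanishes_at_colspan => //.
rewrite mevalXU /plucker enum_rankK mulmx_coord /determinant big1 // => s _.
suff [i nri] : exists i, ~~ r (tnth (val k) i) (f (s i)).
  by rewrite (bigD1 i) //= !mxE (proj2 tg) // mul0r mulr0.
apply/existsP; apply: contraNT nr_i0; rewrite negb_exists => /forallP rk.
by apply: (r_perm k_incr f_incr (s := s)) => i; have := rk i; rewrite negbK.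
Qed.

Hypothesis r_total : total r.
Hypothesis d_lt_n : (d < n)%N.
Implicit Types u w : 'S_n.

Lemma fixed_point_coset_enum u :
  fixed_point K d u = colspan (coord_mx K (coset_enum (ltnW d_lt_n) u)).
Proof. by apply: fixed_pointE => i; apply: coset_enum_range. Qed.

(** The identity e_a + t e_c = t (e_c + t^-1 e_a) behind the gluing of the two charts of a T-stable
    line; the other basis vectors are fixed by both transvections. *)
Lemma subspace_act_transvection u (a c : 'I_n) t :
  t != 0 -> (exists2 i : 'I_n, (i < d)%N & a = u i) ->
  (exists2 j : 'I_n, (d <= j)%N & c = u j) ->
  subspace_act (1%:M + t *: delta_mx c a) (fixed_point K d u) =
  subspace_act (1%:M + t^-1 *: delta_mx a c) (fixed_point K d (u * tperm a c)%g).
Proof.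
move=> nzt [i0 i0d a_u] [j0 dj0 c_u].
pose f := coset_enum (ltnW d_lt_n) u.
have fP : forall i, (exists j, u i = f j) <-> (i < d)%N
  by apply: coset_enum_range.
have fc j : f j != c.
  apply/eqP => fj; have : (j0 < d)%N by apply/fP; exists j; rewrite fj.
  by rewrite ltnNge dj0.
have ac : a != c by have /fP[j] := i0d; rewrite -a_u => ->.
rewrite (fixed_pointE K fP) (@fixed_pointE _ _ _ _ (tperm a c \o f)); last first.
  move=> i; rewrite permM -fP; split=> -[j]; last by move=> ->; exists j.
  by move=> /perm_inj ->; exists j.
rewrite !subspace_act_colspan !mulmx_coord; apply/esym.
apply: (@colspan_scale_col _ _ _ _ _ (fun j => if f j == a then t^-1 else 1)) => [j|i j].
  by case: ifP; rewrite ?invr_eq0 ?oner_eq0.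
rewrite !mxE /=; have [->|fja] := eqVneq (f j) a.
  rewrite tpermL !eqxx !andbT mulrDr mulrA mulVf // mul1r.
  by rewrite addrC.
rewrite tpermD 1?eq_sym // [f j == c](negbTE (fc j)) !andbF !mulr0 !addr0.
by rewrite mul1r.
Qed.

(** By totality of [r], one of the two opposite transvections lies in the group. The point is then a
    group translate of e_u or, after [subspace_act_transvection], of the reflected fixed point, and
    both fixed points lie below w for [r]. *)
Lemma tri_closure_line u w (a c : 'I_n) t :
  t != 0 -> (exists2 i : 'I_n, (i < d)%N & a = u i) ->
  (exists2 j : 'I_n, (d <= j)%N & c = u j) ->
  (forall j, r (coset_enum (ltnW d_lt_n) u j) (coset_enum (ltnW d_lt_n) w j)) ->
  (forall j, r (coset_enum (ltnW d_lt_n) (u * tperm a c)%g j)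
               (coset_enum (ltnW d_lt_n) w j)) ->
  zariski_closure d (orbit_of tri_group (fixed_point K d w))
    (subspace_act (1%:M + t *: delta_mx c a) (fixed_point K d u)).
Proof.
move=> nzt ua uc r_uw r_sw.
have ac : a != c.
  case: ua uc => i id -> [j dj ->]; rewrite (inj_eq perm_inj).
  by apply: contraTneq dj => <-; rewrite -ltnNge.
have tri_elem (x y : 'I_n) z : r x y -> x != y -> tri_group (1%:M + z *: delta_mx x y).
  move=> rxy xy.
  have g0 i j : ~~ r i j -> (1%:M + z *: delta_mx x y) i j = 0.
    move=> nr; rewrite !mxE.
    have /negbTE-> : i != j by apply: contraNneq nr => ->.
    case: eqP nr => [->|_ _]; last by rewrite mulr0 addr0.
    by case: eqP => [->|_ _]; rewrite ?rxy // mulr0 addr0.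
  split=> //; rewrite (det_r g0) big1 // => i _; rewrite !mxE eqxx.
  case: eqP => [->|_]; last by rewrite mulr0 addr0.
  by rewrite (negbTE xy) mulr0 addr0.
have clE x g :
    (forall j, r (coset_enum (ltnW d_lt_n) x j) (coset_enum (ltnW d_lt_n) w j)) ->
    tri_group g -> zariski_closure d (orbit_of tri_group (fixed_point K d w))
    (subspace_act g (fixed_point K d x)).
  move=> r_xw tg; rewrite !fixed_point_coset_enum subspace_act_colspan.
  by apply: tri_orbit_closure => //; apply: coset_enum_inj.
have /orP[rca|rac] := r_total c a.
  by apply: clE => //; apply: tri_elem; rewrite // eq_sym.
by rewrite subspace_act_transvection //; apply: clE => //; apply: tri_elem.
Qed.

End TriangularOrbits.

(** * Plucker equations, lines and tangent vectors of Richardson varieties *)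

Section RichardsonVarieties.
Variables (K : closedFieldType) (n d : nat).
Hypothesis d_lt_n : (d < n)%N.
Implicit Types u w tau v : 'S_n.

Let row_leq : rel 'I_n := fun i j => (i <= j)%N.
Let row_geq : rel 'I_n := fun i j => (j <= i)%N.

Lemma row_leq_trans : transitive row_leq.
Proof. by move=> j i k; apply: leq_trans. Qed.

Lemma row_geq_trans : transitive row_geq.
Proof. by move=> j i k ji kj; apply: leq_trans kj ji. Qed.

Lemma det_row_leq (g : 'M[K]_n) :
  (forall i j, ~~ row_leq i j -> g i j = 0) -> \det g = \prod_i g i i.
Proof.
move=> g0; rewrite -det_tr det_trig; first by apply: eq_bigr => i _; rewrite mxE.
by apply/is_trig_mxP => i j ij; rewrite mxE g0 // /row_leq -ltnNge.
Qed.

Lemma det_row_geq (g : 'M[K]_n) :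
  (forall i j, ~~ row_geq i j -> g i j = 0) -> \det g = \prod_i g i i.
Proof.
move=> g0; apply: det_trig.
by apply/is_trig_mxP => i j ij; rewrite g0 // /row_geq -ltnNge.
Qed.

Lemma row_geq_perm (k f : 'I_d -> 'I_n) (s : 'S_d) :
  {homo k : i j / (i < j)%N >-> (i < j)%N} ->
  {homo f : i j / (i < j)%N >-> (i < j)%N} ->
  (forall i, row_geq (k i) (f (s i))) -> forall i, row_geq (k i) (f i).
Proof.
(* Reversing the inequality exchanges the roles of [k] and [f], so the matching is read through the
   inverse permutation. *)
move=> k_incr f_incr kf; apply: (perm_leq_pointwise (s := s^-1) f_incr k_incr) => i.
by have := kf ((s^-1)%g i); rewrite permKV.
Qed.

Lemma borelE (g : 'M[K]_n) : borel g <-> tri_group row_leq g.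
Proof.
by split=> -[dg g0]; split=> // i j; rewrite -?ltnNge => ij; apply: g0; rewrite // -ltnNge.
Qed.

Lemma opp_borelE (g : 'M[K]_n) : opp_borel g <-> tri_group row_geq g.
Proof.
by split=> -[dg g0]; split=> // i j; rewrite -?ltnNge => ij; apply: g0; rewrite // -ltnNge.
Qed.

Lemma schubertE w V : schubert d w V <->
  zariski_closure d (orbit_of (tri_group (K := K) row_leq) (fixed_point K d w)) V.
Proof.
split; apply: closure_mono => U [g gP ->]; exists g => //; exact/borelE.
Qed.

Lemma opp_schubertE w V : opp_schubert d w V <->
  zariski_closure d (orbit_of (tri_group (K := K) row_geq) (fixed_point K d w)) V.
Proof.
split; apply: closure_mono => U [g gP ->]; exists g => //; exact/opp_borelE.
Qed.

Local Notation cindex := (coset_index (ltnW d_lt_n)).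
Local Notation cenum := (coset_enum (ltnW d_lt_n)).

Lemma richardson_plucker0 w v x V :
  richardson d w v V -> ~~ (ge_modWP d w x && ge_modWP d x v) ->
  vanishes_at ('X_(enum_rank (cindex x)) : {mpoly K[#|{: plucker_index n d}|]}) V.
Proof.
move=> [/schubertE Vw /opp_schubertE Vv].
rewrite (fixed_point_coset_enum _ d_lt_n) in Vw.
rewrite (fixed_point_coset_enum _ d_lt_n) in Vv.
have out (y z : 'S_n) : ~~ ge_modWP d y z -> exists i, ~~ (cenum z i <= cenum y i)%N.
  move=> nyz; apply/existsP; apply: contraNT nyz; rewrite negb_exists => /forallP le_zy.
  by apply/(ge_modWPP (ltnW d_lt_n)) => i; have := le_zy i; rewrite negbK.
rewrite negb_and => /orP[/out nle|/out nle].
  exact: (tri_closure_plucker0 (r := row_leq) (@perm_leq_pointwise n d)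
    (@coset_enum_lt _ _ _ w) (@coset_enum_inj _ _ _ w) nle Vw).
exact: (tri_closure_plucker0 (r := row_geq) row_geq_perm
    (@coset_enum_lt _ _ _ v) (@coset_enum_inj _ _ _ v) nle Vv).
Qed.

Lemma richardson_line w tau v b t :
  b \in tangent_roots d tau -> ge_modWP d w tau -> ge_modWP d tau v ->
  ge_modWP d w (refl_mul b tau) -> ge_modWP d (refl_mul b tau) v -> t != 0 ->
  richardson d w v
    (subspace_act (1%:M + t *: root_vector K (opp_root b)) (fixed_point K d tau)).
Proof.
move=> /tangent_rootsP[ba bc].
move=> /(ge_modWPP (ltnW d_lt_n)) w_tau /(ge_modWPP (ltnW d_lt_n)) tau_v.
move=> /(ge_modWPP (ltnW d_lt_n)) w_s /(ge_modWPP (ltnW d_lt_n)) s_v nzt.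
split.
  apply/schubertE; apply: (tri_closure_line (r := row_leq)) => //.
  - exact: row_leq_trans.
  - exact: det_row_leq.
apply/opp_schubertE; apply: (tri_closure_line (r := row_geq)) => //.
- by move=> i; apply: leqnn.
- exact: row_geq_trans.
- exact: det_row_geq.
Qed.

(* Listing the columns of A in the order of the sorted row set of s_beta tau,
   transported by s_beta, makes the minor equal to the identity up to one row,
   so that no sign appears. *)
Lemma plucker_differential (X : {vspace 'cV[K]_n} -> Prop) tau xi b :
  xi \in grass_tangent K d tau -> b \in tangent_roots d tau ->
  (forall V, X V -> vanishes_at
     ('X_(enum_rank (cindex (refl_mul b tau))) : {mpoly K[#|{: plucker_index n d}|]}) V) ->
  lie_tangent d X (fixed_point K d tau) xi -> xi b.2 b.1 = 0.
Proof.
case: b => a c /= xi_tau b_tau; set s := tperm a c.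
have /tangent_rootsP[[/= i1 i1d a_tau] [j1 dj1 c_tau]] := b_tau.
rewrite /refl_mul /reflection /= -/s.
set k := enum_rank _ => Xk Txi; pose f := cenum (tau * s)%g.
have ac : a != c.
  by rewrite a_tau c_tau (inj_eq perm_inj); apply: contraTneq dj1 => <-; rewrite -ltnNge.
have fP : forall i, (exists j, (tau * s)%g i = f j) <-> (i < d)%N
  by apply: coset_enum_range.
have Ef : fixed_point K d tau = colspan (coord_mx K (s \o f)).
  apply: fixed_pointE => i; rewrite -fP permM; split=> -[j].
    by move=> /(congr1 s) /=; rewrite tpermK; exists j.
  by move=> sfj; exists j; rewrite /= -sfj tpermK.
have [i0 fi0] : exists i0, f i0 = c.
  have /fP[i0] := i1d; rewrite permM -a_tau tpermL => fi0; by exists i0.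
(* Apart from c, the values of [f] are values of tau at indices < d; [xi] is supported on rows
   tau(j) with j >= d, so these rows of it vanish. *)
have fj j : j != i0 -> s (f j) = f j /\ (forall l, xi (f j) l = 0).
  move=> ji0; have fjc : f j != c by rewrite -fi0 (inj_eq (@coset_enum_inj _ _ _ _)).
  have [i tsi] : exists i, (tau * s)%g i = f j
    by exists (((tau * s)^-1)%g (f j)); rewrite permKV.
  have id : (i < d)%N by apply/fP; exists j.
  have fja : f j != a.
    apply: contraTneq id => fja; move: tsi; rewrite fja permM => /(congr1 s).
    by rewrite tpermK tpermL c_tau => /perm_inj ->; rewrite -leqNgt.
  have sfj : s (f j) = f j by rewrite tpermD // eq_sym.
  split=> // l; apply: (grass_tangent_support xi_tau).
  apply/tangent_rootsP => -[_ [i' di' /=]].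
  by rewrite -sfj -tsi permM tpermK => /perm_inj ei; rewrite -ei leqNgt id in di'.
have Xhom : homogeneous ('X_k : {mpoly K[#|{: plucker_index n d}|]}).
  by exists 1%N; rewrite dhomogX /= mdeg1.
have := Txi _ (esym Ef) 'X_k Xhom Xk.
rewrite (bigD1 k) //= big1 => [|l /negbTE lk]; last first.
  by rewrite mderivX mnm1E eq_sym lk scale0r meval0 mul0r.
rewrite mderivX mnm1E eqxx scale1r -[X in (X - _)%MM]add0m addmK mpolyX0 meval1.
rewrite mul1r addr0 /orbit_differential orbit_curveE mulmx_coord /plucker enum_rankK.
rewrite -/(cenum (tau * s)%g) -/f; set M := rowsub _ _.
have ME i j : M i j = (f i == s (f j))%:R%:P + 'X * (xi (f i) (s (f j)))%:P.
  by rewrite !mxE.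
have Mrow i j : i != i0 -> M i j = (i == j)%:R.
  move=> /fj[sfi xi0]; rewrite ME xi0 mulr0 addr0 -{1}sfi (inj_eq perm_inj).
  by rewrite (inj_eq (@coset_enum_inj _ _ _ _)) polyC_natr.
(* All rows but [i0] are rows of the identity, so column [i0] has only its diagonal entry off zero,
   and the complementary minor is 1. *)
rewrite (expand_det_col _ i0) (bigD1 i0) //= big1 => [|i ii0]; last first.
  by rewrite Mrow // (negbTE ii0) mul0r.
have -> : cofactor M i0 i0 = 1.
  rewrite /cofactor -signr_odd oddD addbb mul1r -[RHS](det1 _ d.-1); congr (\det _).
  apply/matrixP => i j; rewrite [LHS]mxE [LHS]mxE [RHS]mxE Mrow.
    by rewrite (inj_eq lift_inj).
  by rewrite eq_sym neq_lift.
(* The surviving entry is the variable times [xi c a], because a and c differ. *)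
rewrite addr0 mulr1 ME fi0 tpermR [c == a]eq_sym (negbTE ac) add0r.
by rewrite coefXM /= coefC.
Qed.

End RichardsonVarieties.

(** * Linear independence and the two inclusions *)

Theorem theorem6p7p2 (K : closedFieldType) (n d : nat)
    (hd : (1 <= d)%N) (hdn : (d < n)%N) (w tau v : 'S_n)
    (hw : minimal_rep d w) (htau : minimal_rep d tau) (hv : minimal_rep d v)
    (hwtau : ge_modWP d w tau) (htauv : ge_modWP d tau v) :
  is_basis
    (@richardson_tangent K n d w tau v)
    [seq @root_vector K n (opp_root b)
       | b in [set b in tangent_roots d tau
              | ge_modWP d w (refl_mul b tau) && ge_modWP d (refl_mul b tau) v]].
Proof.
set S := [set b in _ | _].
have -> : [seq root_vector K (opp_root b) | b in S] =
  [seq root_vector K p | p <- [seq opp_root b | b in S]] by rewrite -map_comp.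
(* Indices are swapped because the matrix unit at (i, j) is X_{-beta} for beta = (j, i). *)
have mem_opp i j : ((i, j) \in [seq opp_root b | b in S]) = ((j, i) \in S).
  apply/mapP/idP => [[[a c]]|ji]; first by rewrite mem_enum => acS [-> ->].
  by exists (j, i); rewrite ?mem_enum.
split.
  apply: free_root_vectors; rewrite map_inj_uniq ?enum_uniq //.
  by move=> [a c] [a' c'] [-> ->].
move=> xi; split=> [[xi_tau Txi]|xiS].
  apply/span_root_vectorP => i j; rewrite mem_opp inE.
  (* A coefficient of [xi] is zero either because its root is not tangent to the Grassmannian, or
     because the Pluecker coordinate of s_beta tau vanishes on the Richardson variety. *)
  have [ji /= out|ji _] := boolP ((j, i) \in tangent_roots d tau); last first.
    exact: grass_tangent_support xi_tau ji.
  apply: (plucker_differential (d_lt_n := hdn) xi_tau ji _ Txi) => V XV.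
  exact: richardson_plucker0 XV out.
split.
  apply: (subvP _ _ xiS); apply/span_subvP => _ /mapP[p + ->].
  move=> /mapP[b + ->]; rewrite mem_enum inE => /andP[b_tau _].
  by apply/(subvP (sumv_sup b b_tau (subvv _)))/memv_line.
(* Tangency is a linear condition, so it is checked on the generators, each of which is the
   direction of a punctured line in the Richardson variety. *)
apply: lie_tangent_span xiS => _ /mapP[p + ->].
move=> /mapP[b + ->]; rewrite mem_enum inE => /and3P[b_tau w_s s_v].
by apply: lie_tangent_curve => t nzt; apply: richardson_line.
Qed.
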